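(* Let $G(z)=\sum_{p=0}^{d}z^pA_p+\sum_{j=1}^k w_j(z)E_j$ be an $n\times n$ rational matrix polynomial with $(A_0,\ldots,A_d,E_1,\ldots,E_k)\in\mathbb{S}$, where $\mathbb{S}\in\{\mathbb{S}_e,\mathbb{S}_o,(\mathrm{SHerm}(n))^{d+k+1}\}$. Let $\lambda\in\mathbb{C}$ be such that $\lambda$ is not a pole of $G(z)$ and $w_j(\lambda)\ne0$ for $j=1,\ldots,k$, and define $R(z)=G(iz)$. Then the following hold. (1) When $\mathbb{S}=(\mathrm{SHerm}(n))^{d+k+1}$: $\eta^{\mathrm{SHerm}}(G,\lambda)=\eta^{\mathrm{Herm}}(iG,\lambda)$. (2) When $\mathbb{S}=\mathbb{S}_e$: $\eta^{\mathrm{even}_*}(G,\lambda)=\eta^{\mathrm{Herm}}(R,\tfrac{\lambda}{i})$. (3) When $\mathbb{S}=\mathbb{S}_o$: $\eta^{\mathrm{odd}_*}(G,\lambda)=\eta^{\mathrm{Herm}}(iR,\tfrac{\lambda}{i})$.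
   Context: A rational matrix polynomial (RMP) is $G(z)=\sum_{p=0}^d z^pA_p+\sum_{j=1}^k w_j(z)E_j$ with $A_p,E_j\in\mathbb{C}^{n\times n}$ and $w_j(z)=s_j(z)/q_j(z)$, where $s_j,q_j$ are scalar polynomials, $q_j\not\equiv0$. The poles of $G(z)$ are the roots of the $q_j$. An RMP is regarded as given together with its coefficient matrices $A_p,E_j$ and weight functions $w_j$. $\|\cdot\|$ is the spectral norm. For a tuple of $n\times n$ matrices, the tuple norm is $$|||(\Delta A_0,\ldots,\Delta A_d,\Delta E_1,\ldots,\Delta E_k)|||:=\sqrt{\textstyle\sum_{p=0}^d\|\Delta A_p\|^2+\sum_{j=1}^k\|\Delta E_j\|^2}.$$ For $\mathbb{S}\subseteq(\mathbb{C}^{n\times n})^{d+k+1}$ the structured eigenvalue backward error $\eta^{\mathbb{S}}(G,\lambda)$ is the infimum of $|||(\Delta A_0,\ldots,\Delta E_k)|||$ over all $(\Delta A_0,\ldots,\Delta A_d,\Delta E_1,\ldots,\Delta E_k)\in\mathbb{S}$ with $$\det\Big(\sum_{p=0}^d\lambda^p(A_p-\Delta A_p)+\sum_{j=1}^kw_j(\lambda)(E_j-\Delta E_j)\Big)=0.$$ $\mathrm{Herm}(n)$ and $\mathrm{SHerm}(n)$ are the sets of $n\times n$ Hermitian and skew-Hermitian matrices. The sets $\mathbb{S}_e$ and $\mathbb{S}_o$ are defined as follows. $\mathbb{S}_e$ is the set of tuples with $\Delta A_p^*=(-1)^p\Delta A_p$ for $p=0,\ldots,d$ and, for $j=1,\ldots,k$: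 (e1) $\Delta E_j\in\mathrm{Herm}(n)$, in the case $\overline{w_j(-z)}=w_j(\overline z)$ for all $j$; (e2) $\Delta E_j\in\mathrm{SHerm}(n)$, in the case $\overline{w_j(-z)}=-w_j(\overline z)$ for all $j$. $\mathbb{S}_o$ is the set of tuples with $\Delta A_p^*=(-1)^{p+1}\Delta A_p$ for $p=0,\ldots,d$ and, for $j=1,\ldots,k$: (o1) $\Delta E_j\in\mathrm{Herm}(n)$, in the case $\overline{w_j(-z)}=-w_j(\overline z)$ for all $j$; (o2) $\Delta E_j\in\mathrm{SHerm}(n)$, in the case $\overline{w_j(-z)}=w_j(\overline z)$ for all $j$. When $\mathbb{S}=\mathbb{S}_e$ or $\mathbb{S}_o$ it is understood that the weights $w_j$ satisfy the condition of one of the corresponding cases. The backward error $\eta^{\mathbb{S}}(G,\lambda)$ is denoted $\eta^{\mathrm{Herm}}$, $\eta^{\mathrm{SHerm}}$, $\eta^{\mathrm{even}_*}$, $\eta^{\mathrm{odd}_*}$ when $\mathbb{S}=(\mathrm{Herm}(n))^{d+k+1}$, $(\mathrm{SHerm}(n))^{d+k+1}$, $\mathbb{S}_e$, $\mathbb{S}_o$, respectively. The RMPs on the right-hand sides are represented with Hermitian coefficients as follows. $iG$: coefficients $iA_p,\ iE_j$, weights $w_j(z)$. $R$: coefficients $i^pA_p,\ E_j$, weights $w_j(iz)$ in case (e1); coefficients $i^pA_p,\ -iE_j$, weights $i\,w_j(iz)$ in case (e2). $iR$: coefficients $i^{p+1}A_p,\ E_j$, weights $i\,w_j(iz)$ in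 case (o1); coefficients $i^{p+1}A_p,\ iE_j$, weights $w_j(iz)$ in case (o2). *)

(* Defs.v *)
From HB Require Import structures.
From mathcomp Require Import all_boot all_order all_algebra.
From mathcomp Require Import spectral complex.
From mathcomp Require Import boolp classical_sets reals ereal constructive_ereal.

Set Implicit Arguments.
Unset Strict Implicit.
Unset Printing Implicit Defensive.

Import Order.TTheory GRing.Theory Num.Theory.
Local Open Scope classical_set_scope.
Local Open Scope ring_scope.
Local Open Scope sesquilinear_scope.

(* The weights w_j = s_j / q_j are kept as pairs of polynomials, not
   necessarily coprime: the poles are by definition the roots of the q_j. *)
Record rmp (R : realType) (n d k : nat) := Rmp {
  coefA : 'I_d.+1 -> 'M[R[i]]_n;
  coefE : 'I_k -> 'M[R[i]]_n;
  wnum : 'I_k -> {poly R[i]};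
  wden : 'I_k -> {poly R[i]};
  wden_neq0 : forall j, wden j != 0
}.

Definition mxtuple (R : realType) (n d k : nat) : Type :=
  (('I_d.+1 -> 'M[R[i]]_n) * ('I_k -> 'M[R[i]]_n))%type.

Section Rmp.
Context {R : realType} {n d k : nat}.
Implicit Types (G : rmp R n d k) (D : mxtuple R n d k) (z : R[i]).

Definition coeffs G : mxtuple R n d k := (coefA G, coefE G).

Definition weight G (j : 'I_k) z : R[i] := (wnum G j).[z] / (wden G j).[z].

Definition pole G z : Prop := exists j, root (wden G j) z.

Definition rmp_eval G z : 'M[R[i]]_n :=
  \sum_(p < d.+1) z ^+ p *: coefA G p + \sum_(j < k) weight G j z *: coefE G j.

Definition vnorm2 m (x : 'cV[R[i]]_m) : R :=
  Num.sqrt (\sum_(i < m) Normc.normc (x i 0) ^+ 2).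

Definition spectral_norm (M : 'M[R[i]]_n) : R :=
  sup [set vnorm2 (M *m x) | x in [set x : 'cV[R[i]]_n | vnorm2 x <= 1]].

Definition tuple_norm D : R :=
  Num.sqrt (\sum_(p < d.+1) spectral_norm (D.1 p) ^+ 2 +
            \sum_(j < k) spectral_norm (D.2 j) ^+ 2).

Definition perturbed_value G D z : 'M[R[i]]_n :=
  \sum_(p < d.+1) z ^+ p *: (coefA G p - D.1 p) +
  \sum_(j < k) weight G j z *: (coefE G j - D.2 j).

(* The infimum is taken in the extended reals, so that it is +oo when no
   admissible perturbation makes the matrix singular. *)
Definition backward_error (S : set (mxtuple R n d k)) G z : \bar R :=
  ereal_inf [set (tuple_norm D)%:E | D in
    [set D | S D /\ \det (perturbed_value G D z) = 0]].

Definition Herm : set 'M[R[i]]_n := [set M | M ^t* = M].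
Definition SHerm : set 'M[R[i]]_n := [set M | M ^t* = - M].

Definition HermTuples : set (mxtuple R n d k) :=
  [set D | (forall p, Herm (D.1 p)) /\ (forall j, Herm (D.2 j))].

Definition SHermTuples : set (mxtuple R n d k) :=
  [set D | (forall p, SHerm (D.1 p)) /\ (forall j, SHerm (D.2 j))].

(* Identities of rational functions: they are required at the points where
   both sides are defined, since division by 0 is a junk value here. *)
Definition weights_even G : Prop := forall j z,
  ~~ root (wden G j) (- z) -> ~~ root (wden G j) z^* ->
  (weight G j (- z))^* = weight G j z^*.

Definition weights_odd G : Prop := forall j z,
  ~~ root (wden G j) (- z) -> ~~ root (wden G j) z^* ->
  (weight G j (- z))^* = - weight G j z^*.

(* The two disjuncts are the cases (e1) and (e2), resp. (o1) and (o2); the sets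
   are empty when the weights satisfy neither condition.  The conditions are
   incompatible as soon as some weight is not identically 0. *)
Definition EvenTuples G : set (mxtuple R n d k) :=
  [set D | (forall p : 'I_d.+1, (D.1 p) ^t* = (-1) ^+ p *: D.1 p) /\
           ((weights_even G /\ forall j, Herm (D.2 j)) \/
            (weights_odd G /\ forall j, SHerm (D.2 j)))].

Definition OddTuples G : set (mxtuple R n d k) :=
  [set D | (forall p : 'I_d.+1, (D.1 p) ^t* = (-1) ^+ p.+1 *: D.1 p) /\
           ((weights_odd G /\ forall j, Herm (D.2 j)) \/
            (weights_even G /\ forall j, SHerm (D.2 j)))].

Definition eta_Herm G z := backward_error HermTuples G z.
Definition eta_SHerm G z := backward_error SHermTuples G z.
Definition eta_even G z := backward_error (EvenTuples G) G z.
Definition eta_odd G z := backward_error (OddTuples G) G z.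

Definition rmp_i G : rmp R n d k :=
  {| coefA := fun p => 'i *: coefA G p;
     coefE := fun j => 'i *: coefE G j;
     wnum := wnum G;
     wden := wden G;
     wden_neq0 := wden_neq0 G |}.
Lemma comp_iX_neq0 (q : {poly R[i]}) : q != 0 -> q \Po ('i *: 'X) != 0.
Proof.
move=> q0; rewrite comp_poly2_eq0 //.
by rewrite size_scale ?size_polyX // neq0Ci.
Qed.

(* Coefficients a i^p A_p and c E_j, weights u w_j(iz). *)
Definition rmp_rot (a c u : R[i]) G : rmp R n d k :=
  {| coefA := fun p : 'I_d.+1 => (a * 'i ^+ p) *: coefA G p;
     coefE := fun j => c *: coefE G j;
     wnum := fun j => u *: (wnum G j \Po ('i *: 'X));
     wden := fun j => wden G j \Po ('i *: 'X);
     wden_neq0 := fun j => comp_iX_neq0 (wden_neq0 G j) |}.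

(* For R(z) = G(iz): the first two represent R, the last two represent iR. *)
Definition rmp_R_e1 G := rmp_rot 1 1 1 G.
Definition rmp_R_e2 G := rmp_rot 1 (- 'i) 'i G.
Definition rmp_iR_o1 G := rmp_rot 'i 1 'i G.
Definition rmp_iR_o2 G := rmp_rot 'i 'i 1 G.

Lemma weight_rot a c u G j z :
  weight (rmp_rot a c u G) j z = u * weight G j ('i * z).
Proof. by rewrite /weight /= hornerZ !horner_comp hornerZ hornerX mulrA. Qed.

Lemma rmp_rotE a c u G z :
  u * c = a -> rmp_eval (rmp_rot a c u G) z = a *: rmp_eval G ('i * z).
Proof.
move=> uca; rewrite /rmp_eval scalerDr !scaler_sumr; congr (_ + _).
  apply: eq_bigr => p _ /=.
  by rewrite !scalerA exprMn mulrCA; congr (_ *: _); rewrite [z ^+ p * _]mulrC.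
apply: eq_bigr => j _ /=.
by rewrite weight_rot !scalerA -uca mulrAC.
Qed.

Lemma rmp_iE G z : rmp_eval (rmp_i G) z = 'i *: rmp_eval G z.
Proof.
rewrite /rmp_eval scalerDr !scaler_sumr; congr (_ + _);
  by apply: eq_bigr => j _; rewrite /= !scalerA mulrC.
Qed.

Lemma rmp_R_e1E G z : rmp_eval (rmp_R_e1 G) z = rmp_eval G ('i * z).
Proof. by rewrite rmp_rotE ?mulr1 // scale1r. Qed.

Lemma rmp_R_e2E G z : rmp_eval (rmp_R_e2 G) z = rmp_eval G ('i * z).
Proof. by rewrite rmp_rotE ?scale1r // mulrN -expr2 sqrCi opprK. Qed.

Lemma rmp_iR_o1E G z : rmp_eval (rmp_iR_o1 G) z = 'i *: rmp_eval G ('i * z).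
Proof. by rewrite rmp_rotE ?mulr1. Qed.

Lemma rmp_iR_o2E G z : rmp_eval (rmp_iR_o2 G) z = 'i *: rmp_eval G ('i * z).
Proof. by rewrite rmp_rotE ?mul1r. Qed.

End Rmp.

(* Main.v *)
Require Import Defs.
From mathcomp Require Import all_boot all_order all_algebra.
From mathcomp Require Import spectral complex.
From mathcomp Require Import boolp classical_sets reals ereal constructive_ereal.

(** Multiplying a matrix by a unimodular scalar [a] does not change its spectral
    norm, and it turns the twisted symmetry [M ^t* = e *: M] into the Hermitian
    one as soon as [a^* * e = a].  Skew-Hermitian matrices ([e = -1]) are thus
    rotated to Hermitian ones by [a = 'i] or [a = - 'i], and the alternating
    symmetry [e = (-1) ^+ p] of the polynomial coefficients by [a = 'i ^+ p].
    Each backward error on the left of the theorem is an infimum over tuples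
    with such twisted symmetries, and each representation on the right has the
    coefficients of [G] rotated by the matching scalars, with weights and
    evaluation point changed so that the value of the perturbed rational matrix
    is only multiplied by a nonzero scalar.  Rotating the perturbations along
    with the coefficients is therefore a norm-preserving bijection between the
    two sets of admissible perturbations ([backward_error_rotate]).

    What remains is to see that the even and odd structures are of this form.
    They are unions of two cases, and the two cases can only hold together if
    every weight vanishes at all but finitely many points, hence identically;
    this is excluded by [weight G j lambda != 0] unless there are no weights at
    all ([weights_even_odd_false]), and then the two cases coincide. *)

Set Implicit Arguments.
Unset Strict Implicit.
Unset Printing Implicit Defensive.

Import Order.TTheory GRing.Theory Num.Theory.
Local Open Scope classical_set_scope.
Local Open Scope ring_scope.
Local Open Scope sesquilinear_scope.

(** * Unimodular multiples and symmetry of matrices *)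

Section Rotation.
Context {R : realType} {n : nat}.
Implicit Types (a e : R[i]) (M : 'M[R[i]]_n).

Lemma vnorm2Z m a (x : 'cV[R[i]]_m) : `|a| = 1 -> vnorm2 (a *: x) = vnorm2 x.
Proof.
move=> a1; rewrite /vnorm2; congr Num.sqrt; apply: eq_bigr => i _.
have na : Normc.normc a = 1 by case: a a1 => r s [].
by rewrite mxE Normc.normcM na mul1r.
Qed.

Lemma spectral_normZ a M : `|a| = 1 -> spectral_norm (a *: M) = spectral_norm M.
Proof.
move=> a1; rewrite /spectral_norm; congr sup.
by apply: eq_imagel => x _; rewrite -scalemxAl vnorm2Z.
Qed.

Lemma Herm_rotate a e M :
  a != 0 -> a^* * e = a -> (M ^t* = e *: M) <-> Herm (a *: M).
Proof.
move=> a0 ae; have ac0 : a^* != 0 by rewrite conjC_eq0.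
have tcZ : (a *: M) ^t* = a^* *: M ^t*.
  by apply/matrixP => i j; rewrite !mxE rmorphM.
rewrite /Herm /= tcZ -[in X in _ <-> _ = X]ae -scalerA.
by split=> [-> //|/(scalerI ac0)].
Qed.

End Rotation.

(** * Rotating a perturbation problem *)

Section Backward.
Context {R : realType} {n d k : nat}.
Implicit Types (G H : rmp R n d k) (D : mxtuple R n d k).

Definition twisted_tuples (e : 'I_d.+1 -> R[i]) (f : R[i]) :
    set (mxtuple R n d k) :=
  [set D | (forall p, (D.1 p) ^t* = e p *: D.1 p) /\
           (forall j, (D.2 j) ^t* = f *: D.2 j)].

Definition rotate (a : 'I_d.+1 -> R[i]) (c : R[i]) D : mxtuple R n d k :=
  (fun p => a p *: D.1 p, fun j => c *: D.2 j).

Lemma rotateVK (a : 'I_d.+1 -> R[i]) c D : (forall p, a p != 0) -> c != 0 ->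
  rotate a c (rotate (fun p => (a p)^-1) c^-1 D) = D.
Proof.
move=> a0 c0; case: D => D1 D2.
by congr pair; apply: funext => p; rewrite /= scalerA divff // scale1r.
Qed.

Lemma tuple_norm_rotate (a : 'I_d.+1 -> R[i]) c D :
  (forall p, `|a p| = 1) -> `|c| = 1 -> tuple_norm (rotate a c D) = tuple_norm D.
Proof.
move=> a1 c1; rewrite /tuple_norm.
under eq_bigr do rewrite spectral_normZ //.
by under [X in _ + X]eq_bigr do rewrite spectral_normZ //.
Qed.

(** The hypotheses on [z] and the weights are what makes the perturbed value of
    [H] at [z] equal to [u] times that of [G] at [lambda], term by term; those
    on [e] and [f] make the rotated symmetries Hermitian. *)
Lemma backward_error_rotate G H (a e : 'I_d.+1 -> R[i]) (c f u lambda z : R[i]) :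
    (forall p, `|a p| = 1) -> `|c| = 1 -> u != 0 ->
    (forall p, coefA H p = a p *: coefA G p) ->
    (forall j, Defs.coefE H j = c *: Defs.coefE G j) ->
    (forall p, (a p)^* * e p = a p) -> c^* * f = c ->
    (forall p : 'I_d.+1, z ^+ p * a p = u * lambda ^+ p) ->
    (forall j, weight H j z * c = u * weight G j lambda) ->
  backward_error (twisted_tuples e f) G lambda = eta_Herm H z.
Proof.
move=> a1 c1 u0 HA HE ae cf za wc.
have a0 p : a p != 0 by rewrite -normr_eq0 a1 oner_eq0.
have c0 : c != 0 by rewrite -normr_eq0 c1 oner_eq0.
have symE D : twisted_tuples e f D <-> HermTuples (rotate a c D).
  split=> -[D1 D2]; split=> i.
  - exact: (Herm_rotate _ (a0 i) (ae i)).1 (D1 i).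
  - exact: (Herm_rotate _ c0 cf).1 (D2 i).
  - exact: (Herm_rotate _ (a0 i) (ae i)).2 (D1 i).
  - exact: (Herm_rotate _ c0 cf).2 (D2 i).
have valE D : perturbed_value H (rotate a c D) z = u *: perturbed_value G D lambda.
  rewrite /perturbed_value scalerDr !scaler_sumr; congr (_ + _);
    apply: eq_bigr => i _ /=.
    by rewrite HA -scalerBr !scalerA za.
  by rewrite HE -scalerBr !scalerA wc.
have detE D : \det (perturbed_value H (rotate a c D) z) = 0 <->
              \det (perturbed_value G D lambda) = 0.
  rewrite valE detZ; split=> [/eqP|->]; last by rewrite mulr0.
  by rewrite mulf_eq0 expf_eq0 (negPf u0) andbF => /eqP.
rewrite /eta_Herm /backward_error; congr ereal_inf.
apply/seteqP; split=> _ [D [SD det0] <-].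
  exists (rotate a c D); last by rewrite tuple_norm_rotate.
  by split; [apply/symE | apply/detE].
have DE := rotateVK D a0 c0.
exists (rotate (fun p => (a p)^-1) c^-1 D).
  by split; [apply/symE; rewrite DE | apply/detE; rewrite DE].
by rewrite -[in RHS]DE (tuple_norm_rotate _ a1 c1).
Qed.

Lemma conjCi_iX m : (('i : R[i]) ^+ m)^* * (-1) ^+ m = 'i ^+ m.
Proof. by rewrite rmorphXn /= conjCi -exprMn mulrN1 opprK. Qed.

(** At [lambda / 'i] the weights [u * w ('i * z)] take the value [u * w lambda],
    and the factors ['i ^+ p] absorb the powers of ['i] in the denominator; they
    also turn the sign [(-1) ^+ p] of the twisted symmetry into [1]. *)
Lemma backward_error_rmp_rot G (a c u s f lambda : R[i]) :
    `|a| = 1 -> `|c| = 1 -> u * c = a -> a^* * s = a -> c^* * f = c ->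
  backward_error (twisted_tuples (fun p => s * (-1) ^+ p) f) G lambda =
    eta_Herm (rmp_rot a c u G) (lambda / 'i).
Proof.
move=> a1 c1 uc sa cf; have i0 := neq0Ci R[i].
apply: (@backward_error_rotate _ _ (fun p => a * 'i ^+ p) _ c _ a) => //.
- by move=> p; rewrite normrM a1 normrX normCi expr1n mulr1.
- by rewrite -normr_eq0 a1 oner_eq0.
- by move=> p; rewrite rmorphM /= mulrACA sa conjCi_iX.
- by move=> p; rewrite mulrCA -exprMn divfK.
- by move=> j; rewrite weight_rot ['i * _]mulrC divfK // mulrAC uc.
Qed.

(** * The two cases of the even and odd structures *)

(** The two parities force the weight to be its own opposite off the roots of
    the denominator and of its reflection; the numerator then has infinitely
    many roots. *)
Lemma weights_even_odd_false G lambda j :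
  weight G j lambda != 0 -> weights_even G -> ~ weights_odd G.
Proof.
move=> w0 Ge Go.
pose r := wden G j \Po (- 'X).
(* [r * q] vanishes where the parity conditions are silent: [r] at the [z] such
   that [- z] is a pole, [q] at those such that [z^*] is one. *)
pose q := map_poly Num.conj (wden G j).
pose s := map_poly Num.conj (wnum G j).
have prod0 : r * q * s = 0.
  (* A nonzero polynomial does not vanish at all natural numbers. *)
  apply/eqP/negPn/negP => nz.
  pose rs := [seq (m%:R : R[i]) | m <- iota 0 (size (r * q * s))].
  have urs : uniq rs.
    by rewrite map_inj_uniq ?iota_uniq // => x y /eqP; rewrite eqr_nat => /eqP.
  have /(max_poly_roots nz)/(_ urs) : all (root (r * q * s)) rs.
    apply/allP => _ /mapP[m _ ->].
    rewrite !rootM -!orbA.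
    have qE (p : {poly R[i]}) :
        root (map_poly Num.conj p) m%:R = root p (m%:R)^*.
      by rewrite -[X in root (map_poly _ _) X]conjCK fmorph_root.
    have -> : root r m%:R = root (wden G j) (- m%:R).
      by rewrite /r rootE horner_comp hornerN hornerX -rootE.
    rewrite !qE.
    case: (boolP (root (wden G j) (- m%:R))) => //= nr1.
    case: (boolP (root (wden G j) (m%:R)^*)) => //= nr2.
    have := Ge j _ nr1 nr2; rewrite (Go j _ nr1 nr2) => /eqP.
    rewrite eq_sym -subr_eq0 opprK -mulr2n mulrn_eq0 /= mulf_eq0 invr_eq0.
    by rewrite -!rootE (negPf nr2) orbF.
  by rewrite size_map size_iota ltnn.
move/eqP: prod0; rewrite !mulf_eq0 !map_poly_eq0 (negPf (wden_neq0 G j)) orbF.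
rewrite comp_poly2_eq0 ?size_polyN ?size_polyX // (negPf (wden_neq0 G j)) /=.
by move=> /eqP s0; rewrite /weight s0 horner0 mul0r eqxx in w0.
Qed.

Lemma SHermTuplesE :
  (SHermTuples : set (mxtuple R n d k)) = twisted_tuples (fun=> -1) (-1).
Proof.
apply/seteqP; split=> D [D1 D2]; split=> i.
- by rewrite scaleN1r; exact: D1.
- by rewrite scaleN1r; exact: D2.
- by rewrite /SHerm /= D1 scaleN1r.
- by rewrite /SHerm /= D2 scaleN1r.
Qed.

(** Common shape of the even ([s = 1]) and odd ([s = -1]) structures. *)
Definition parity_tuples (s : R[i]) (P Q : Prop) : set (mxtuple R n d k) :=
  [set D | (forall p : 'I_d.+1, (D.1 p) ^t* = (s * (-1) ^+ p) *: D.1 p) /\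
           ((P /\ forall j, Herm (D.2 j)) \/ (Q /\ forall j, SHerm (D.2 j)))].

Lemma EvenTuplesE G :
  EvenTuples G = parity_tuples 1 (weights_even G) (weights_odd G).
Proof.
by apply/seteqP; split=> D [D1 D2]; split=> // p; rewrite D1 mul1r.
Qed.

Lemma OddTuplesE G :
  OddTuples G = parity_tuples (-1) (weights_odd G) (weights_even G).
Proof.
by apply/seteqP; split=> D [D1 D2]; split=> // p; rewrite D1 exprS.
Qed.

Lemma parity_tuples_Herm (s : R[i]) (P Q : Prop) : P -> (Q -> 'I_k -> False) ->
  parity_tuples s P Q = twisted_tuples (fun p => s * (-1) ^+ p) 1.
Proof.
move=> HP nQ; apply/seteqP; split=> D [D1 D2]; split=> //.
  move=> j; rewrite scale1r.
  by case: D2 => [[_ D2]|[HQ _]]; [exact: D2 | case: (nQ HQ j)].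
by left; split=> // j; rewrite /Herm /= D2 scale1r.
Qed.

Lemma parity_tuples_SHerm (s : R[i]) (P Q : Prop) : Q -> (P -> 'I_k -> False) ->
  parity_tuples s P Q = twisted_tuples (fun p => s * (-1) ^+ p) (-1).
Proof.
move=> HQ nP; apply/seteqP; split=> D [D1 D2]; split=> //.
  move=> j; rewrite scaleN1r.
  by case: D2 => [[HP _]|[_ D2]]; [case: (nP HP j) | exact: D2].
by right; split=> // j; rewrite /SHerm /= D2 scaleN1r.
Qed.

End Backward.

Unset Implicit Arguments.

Theorem theorem5p2 (R : realType) (n d k : nat) (G : rmp R n d k)
    (lambda : R[i])
    (hpole : ~ pole G lambda)
    (hw : forall j : 'I_k, weight G j lambda != 0) :
  [/\ (SHermTuples (coeffs G) ->
         eta_SHerm G lambda = eta_Herm (rmp_i G) lambda),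
      (EvenTuples G (coeffs G) ->
         (weights_even G ->
            eta_even G lambda = eta_Herm (rmp_R_e1 G) (lambda / 'i)) /\
         (weights_odd G ->
            eta_even G lambda = eta_Herm (rmp_R_e2 G) (lambda / 'i)))
    & (OddTuples G (coeffs G) ->
         (weights_odd G ->
            eta_odd G lambda = eta_Herm (rmp_iR_o1 G) (lambda / 'i)) /\
         (weights_even G ->
            eta_odd G lambda = eta_Herm (rmp_iR_o2 G) (lambda / 'i)))].
Proof.
have n1 : `|1 : R[i]| = 1 by rewrite normr1.
have ni : `|'i : R[i]| = 1 by rewrite normCi.
have nNi : `|- 'i : R[i]| = 1 by rewrite normrN normCi.
have c1 : (1 : R[i])^* * 1 = 1 by rewrite mulr1 conjC1.
have ci : ('i : R[i])^* * -1 = 'i by rewrite conjCi mulrN1 opprK.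
have cNi : (- 'i : R[i])^* * -1 = - 'i by rewrite rmorphN /= mulNr ci.
have eo : weights_even G -> weights_odd G -> 'I_k -> False.
  by move=> Ge Go j; exact: (weights_even_odd_false (hw j) Ge Go).
split=> _.
- rewrite /eta_SHerm SHermTuplesE.
  apply: (@backward_error_rotate _ _ _ _ _ _ (fun=> 'i) _ 'i _ 'i) => //.
  + exact: neq0Ci.
  + by move=> p; rewrite mulrC.
  + by move=> j; rewrite mulrC.
- rewrite /eta_even EvenTuplesE; split=> Gw.
    rewrite (parity_tuples_Herm _ Gw (fun Go => eo Gw Go)).
    by apply: backward_error_rmp_rot => //; rewrite mulr1.
  rewrite (parity_tuples_SHerm _ Gw (fun Ge => eo Ge Gw)).
  apply: backward_error_rmp_rot => //.
  by rewrite mulrN -expr2 sqrCi opprK.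
- rewrite /eta_odd OddTuplesE; split=> Gw.
    rewrite (parity_tuples_Herm _ Gw (fun Ge => eo Ge Gw)).
    by apply: backward_error_rmp_rot => //; rewrite mulr1.
  rewrite (parity_tuples_SHerm _ Gw (fun Go => eo Gw Go)).
  by apply: backward_error_rmp_rot => //; rewrite mul1r.
Qed.
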